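(* For all $a\in\mathbb{C}$ and $m\in\mathbb{Z}_{\ge1}$, the $M_a(1)$-module $W(a,a,2m)=M_a(1)\otimes\Omega(a,2m)$ induced from the $A_0(M_a(1))=\mathbb{C}[x]$-module $U=\mathbb{C}[x]/((x-a)^{2m})$ has trivial (zero) graded pseudo-trace associated to the vacuum vector, i.e. $\mathrm{pstr}_{W(a,a,2m)}(\mathbf 1,\tau)=0$.
   Context: $\hat{\mathfrak h}$ is the Lie algebra with basis $\alpha_n$ ($n\in\mathbb{Z}$), $\mathbf{k}$, with $[\alpha_m,\alpha_n]=m\delta_{m+n,0}\mathbf{k}$, $\mathbf{k}$ central. $M_a(1)$ is the rank one Heisenberg vertex operator algebra: the $\hat{\mathfrak h}$-module generated by $\mathbf 1$ with $\alpha_n\mathbf 1=0$ ($n\ge0$), $\mathbf k=1$, with conformal vector $\omega^a=\frac12\alpha_{-1}^2\mathbf 1+a\alpha_{-2}\mathbf 1$ and central charge $c=1-12a^2$. Its level zero Zhu algebra is $\mathbb{C}[x]$, $x$ the class of $\alpha_{-1}\mathbf 1$, acting as $\alpha_0$. $W(a,\lambda,k)=M_a(1)\otimes\Omega(\lambda,k)$ is the $\hat{\mathfrak h}$-module induced from $\Omega(\lambda,k)\cong\mathbb{C}[x]/((x-\lambda)^k)$ with $\alpha_n=0$ on $\Omega(\lambda,k)$ for $n>0$, $\mathbf k=1$, $\alpha_0=x$; Jordan basis $u_1,\dots,u_k$ with $\alpha_0u_1=\lambda u_1$, $\alpha_0u_j=\lambda u_j+u_{j-1}$. $L_0^a=\sum_{m>0}\alpha_{-m}\alpha_m+\frac12\alpha_0^2-a\alpha_0$;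 $W(\ell)$ (degree $\ell$) is the generalized $L_0^a$-eigenspace of weight $\ell+\frac12\lambda^2-a\lambda$. $\mathfrak p(\ell)$ is the number of partitions of $\ell$. Graded pseudo-trace: $W$ is strongly interlocked, i.e. its nontrivial proper submodules are finite in number, indecomposable, and form a chain $0=W^{(0)}\subset W^{(1)}\subset\cdots\subset W^{(k)}=W$ with $W^{(j+1)}/W^{(j)}\cong W^{(1)}=Soc(W)$ and $W/W^{(j)}\cong W^{(k-j)}$. In suitable (strongly interlocked) bases of the weight spaces $W_\mu$, weight-preserving operators $\sigma$ coming from the module structure (such as zero modes $o(v)=v_{\mathrm{wt}\,v-1}$ and powers of the nilpotent part $L_0^N$ of $L_0^a$) have $k\times k$ block upper triangular matrices with blocks of size $\dim Soc(W)_\mu$, all diagonal blocks equal to $\sigma|_{Soc(W)_\mu}$, first block row $(A,C_1,\dots,C_{k-2},B)$ and last block column $(B,C_{k-2},\dots,C_1,A)^T$; $\mathrm{pstr}(\sigma|_{W_\mu})=\mathrm{tr}(B)$. The pseudo-trace is computed in the basis $\{b_1u_1,\dots,b_{\mathfrak p(\ell)}u_1,b_1u_2,\dots,b_{\mathfrak p(\ell)}u_k\}$ of $W(\ell)$, where $b_1,\dots,b_{\mathfrak p(\ell)}$ are the monomials $\alpha_{-n_1}\cdots\alpha_{-n_j}$ of degree $\ell$. Then $$\mathrm{pstr}_W(v,\tau)=\sum_\mu\sum_{j\ge0}\mathrm{pstr}\big(o(v)|_{W_\mu}\tfrac1{j!}(L_0^N)_\mu^j\big)(\log q)^jq^{\mu-c/24},\quad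 q=e^{2\pi i\tau},\ \log q=2\pi i\tau.$$ *)

(* Defs.v *)
From HB Require Import structures.
From mathcomp Require Import all_boot all_order all_algebra.
From mathcomp Require Import finmap multiset complex monalg.
From mathcomp Require Import all_classical all_reals all_analysis.

Set Implicit Arguments.
Unset Strict Implicit.
Unset Printing Implicit Defensive.
Import Order.TTheory GRing.Theory Num.Theory.

Local Open Scope mset_scope.
Local Open Scope classical_set_scope.
Local Open Scope ring_scope.
Local Open Scope complex_scope.

(* A multiset b of natural numbers stands for the monomial in which the factor
   alpha_{-(n+1)} occurs b n times; the shift makes all parts positive. *)
Definition mono : choiceType := {mset nat}.

Definition degree (b : mono) : nat := (\sum_(n <- (b : {mset nat})) n.+1)%N.

(* fset_set is a total function, with value fset0 on infinite sets; see
   finite_degree below. *)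
Definition monomials (l : nat) : {fset mono} :=
  fset_set [set b : mono | degree b = l].

Definition npart (l : nat) : nat := #|` monomials l |.

Definition monomial (l i : nat) : mono := nth mset0 (monomials l) i.

(* The Fock space M(1); the conformal vector, hence a, only enters via L0. *)
Notation heisenberg C := {malg C[mono]}.

Definition vacuum (C : fieldType) : heisenberg C := << (mset0 : mono) >>.

(* The module M(1) (x) A induced from a commutative C-algebra A on which
   alpha_0 acts as multiplication by x, the alpha_n, n > 0, act as 0 and k acts
   as 1; elements are polynomials in the alpha_{-n} with coefficients in A. *)
Section Induced.
Variables (C : fieldType) (A : comAlgType C) (x : A).
Local Notation W := {malg A[mono]}.

Definition cscale (c : C) (w : W) : W := c%:A *: w.
Local Notation "c *^ w" := (cscale c w) (at level 40).

Definition alpha (n : int) (w : W) : W :=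
  match n with
  | Posz 0 => x *: w
  | Posz n.+1 =>
      \sum_(b <- msupp w) << w@_b *+ (n.+1 * b n) *g (b `\ n)%mset >>
  | Negz n => \sum_(b <- msupp w) << w@_b *g (n +` b)%mset >>
  end.

(* Y_W(v, z) = \sum_p v_p z^(-p-1) for a monomial v = alpha_{-(n_1+1)} ... 1,
   s = [:: n_1; ...]: with m = n + 1, these are the modes of
     Y_W(alpha_{-m} v, z) = : (1 / (m-1)!) (d/dz)^(m-1) alpha(z) Y_W(v, z) : ,
   where alpha(z) = \sum_r alpha_r z^(-r-1). The first sum collects the
   alpha_r with r = - (i+1) < 0, the second those with r = i >= 0, the
   coefficient being binom(-r-1, m-1) in both cases. For every w, both sums
   have finitely many nonzero terms. *)
Fixpoint monomial_mode (s : seq nat) (p : int) (w : W) : W :=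
  match s with
  | [::] => if p == - 1 then w else 0
  | n :: s' =>
      \sum_(i \in [set: nat])
         alpha (- i.+1%:Z) (monomial_mode s' (p + i%:Z - n%:Z) w) *+ 'C(i, n)
      + \sum_(i \in [set: nat])
         monomial_mode s' (p - i%:Z - n.+1%:Z) (alpha i%:Z w)
           *~ ((-1) ^+ n * ('C(i + n, n))%:Z)
  end.

(* o(v) = v_{wt v - 1} for homogeneous v, extended linearly. *)
Definition zero_mode (v : heisenberg C) (w : W) : W :=
  \sum_(b <- msupp v)
     v@_b *^ monomial_mode (b : {mset nat}) ((degree b)%:Z - 1) w.

Definition L0 (a : C) (w : W) : W :=
  \sum_(m \in [set m : nat | (0 < m)%N]) alpha (- m%:Z) (alpha m%:Z w)
  + 2^-1 *^ alpha 0 (alpha 0 w) - a *^ alpha 0 w.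

Definition gen_eigenspace (a mu : C) : set W :=
  [set w | exists N, iter N (fun w' => L0 a w' - mu *^ w') w = 0].

End Induced.

(* {poly %/ h} is the quotient by h provided h is monic of positive degree,
   i.e. here provided k > 0. *)
Notation Omega lam k := {poly %/ (('X - lam%:P) ^+ k)}.

Notation induced lam k := {malg (Omega lam k)[mono]}.

Section PseudoTrace.
Variables (C : fieldType) (lam : C) (k : nat).
Local Notation Omega := (Omega lam k).
Local Notation W := (induced lam k).

(* u_1, ..., u_k *)
Definition jordan (j : nat) : Omega := in_qpoly _ (('X - lam%:P) ^+ (k - j)).

(* Coordinate along u_j: expand a representative in powers of x - lam. *)
Definition jcoord (j : nat) (p : Omega) : C :=
  (p \Po ('X + lam%:P))`_(k - j).

Definition fock_basis (l j : nat) (i : 'I_(npart l)) : W :=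
  << jordan j *g monomial l i >>.

(* The matrix of sigma|_{W(l)} in the basis b_1 u_1, ..., b_p u_1, b_1 u_2, ...,
   b_p u_k is cut into k x k blocks of size p = npart l; r and s run over
   1, ..., k. *)
Definition block (sigma : W -> W) (l r s : nat) : 'M[C]_(npart l) :=
  \matrix_(i, i') jcoord r (sigma (fock_basis s i'))@_(monomial l i).

Definition pstr (sigma : W -> W) (l : nat) : C := \tr (block sigma l 1 k).

(* The generalized eigenvalue of L0 on W(l). *)
Definition weight (a : C) (l : nat) : C := l%:R + 2^-1 * lam ^+ 2 - a * lam.

(* The nilpotent part of L0, on W(l). *)
Definition L0N (a : C) (l : nat) (w : W) : W :=
  L0 'qX a w - cscale (weight a l) w.

End PseudoTrace.

Definition central_charge (C : fieldType) (a : C) : C := 1 - 12 * a ^+ 2.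

Definition cexp (R : realType) (z : R[i]) : R[i] :=
  (expR (complex.Re z))%:C * (cos (complex.Im z) +i* sin (complex.Im z)).

Import numFieldNormedType.Exports.

Section Graded.
Variables (R : realType) (a lam : R[i]) (k : nat).
Local Notation C := R[i].

Definition log_q (tau : C) : C := 2 * (pi : R)%:C * 'i * tau.

Definition q_pow (tau mu : C) : C := cexp (log_q tau * mu).

Definition gpstr_term (v : heisenberg C) (tau : C) (l j : nat) : C^o :=
  pstr (fun w : induced lam k =>
          zero_mode 'qX v (cscale (j`!%:R)^-1 (iter j (L0N a l) w))) l
  * log_q tau ^+ j * q_pow tau (weight lam a l - central_charge a / 24).

Definition gpstr (v : heisenberg C) (tau : C) : C^o :=
  limn (series (fun l => limn (series (gpstr_term v tau l)))).

(* limn is total, so that gpstr is meaningful under this condition only. *)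
Definition gpstr_converges (v : heisenberg C) (tau : C) : Prop :=
  (forall l, cvgn (series (gpstr_term v tau l))) /\
  cvgn (series (fun l => limn (series (gpstr_term v tau l)))).

End Graded.

(* Main.v *)
Require Import Defs.
From mathcomp Require Import all_boot all_order all_algebra.
From mathcomp Require Import finmap multiset complex monalg.
From mathcomp Require Import all_classical all_reals all_analysis.
From mathcomp Require Import zify ring.
Import Order.TTheory GRing.Theory Num.Theory.
Import numFieldNormedType.Exports.
Local Open Scope ring_scope.
Local Open Scope complex_scope.

(** Write x for the action of alpha_0 and t = x - a for its nilpotent part.  On
    the vectors of degree l the oscillator part of L_0 is the scalar l, so that
      L_0 = l + x^2 / 2 - a x = (l - a^2 / 2) + t^2 / 2 :
    because the highest weight equals the background charge a, the term linear
    in t cancels, and the nilpotent part of L_0 is t^2 / 2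
    ([L0N_fock_vector]).  Its powers only involve even powers of t.  In the
    Jordan basis t^i sends u_k to u_(k-i), and the pseudo-trace reads off the
    coefficient of u_1 in the image of u_k, that is the coefficient of
    t^(k-1) ([jcoord_in_qpoly_exp]).  For k = 2 m the exponent k - 1 is odd, so
    that every single term of the double series is zero. *)

(** * Modes on the vectors of the induced module *)

Section Modes.
Context {C : fieldType} {A : comAlgType C}.
Implicit Types (x c : A) (b : mono) (w : {malg A[mono]}).

(** When c = 0 the support is empty; the hypothesis on F makes both sides agree
    in that case. *)
Lemma sum_msupp_single {G : zmodType} {V : nmodType} (c : G) b
    (F : G -> mono -> V) :
  F 0 b = 0 ->
  \sum_(b' <- msupp << c *g b >>) F (<< c *g b >>)@_b' b' = F c b.
Proof.
move=> F0; rewrite msuppU; case: eqVneq => [->|_].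
  by rewrite big_seq_fset0 F0.
by rewrite big_seq_fset1 mcoeffUU.
Qed.

Lemma alpha_zero x w : alpha x 0 w = x *: w.
Proof. by []. Qed.

Lemma alpha_annihilation x n c b :
  alpha x n.+1%:Z << c *g b >> = << c *+ (n.+1 * b n) *g (b `\ n)%mset >>.
Proof.
rewrite /alpha.
rewrite (sum_msupp_single c b (fun c b => << c *+ (n.+1 * b n) *g (b `\ n)%mset >>)) //.
by rewrite mul0rn monalgU0.
Qed.

Lemma alpha_creation x n c b :
  alpha x (- n.+1%:Z) << c *g b >> = << c *g (n +` b)%mset >>.
Proof.
rewrite /= (sum_msupp_single c b (fun c b => << c *g (n +` b)%mset >>)) //.
by rewrite monalgU0.
Qed.

Lemma alpha_number x n c b :
  alpha x (- n.+1%:Z) (alpha x n.+1%:Z << c *g b >>)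
  = << c *+ (n.+1 * b n) *g b >>.
Proof.
rewrite alpha_annihilation alpha_creation.
have [->|] := eqVneq (b n) 0%N; first by rewrite muln0 mulr0n !monalgU0.
by rewrite mset_neq0 => nb; rewrite msetB1K.
Qed.

(** The oscillator part of L_0 counts the degree: alpha_(-m) alpha_m multiplies
    a monomial by m times the multiplicity of alpha_(-m) in it. *)
Lemma sum_alpha_number x c b :
  \sum_(m \in [set m : nat | (0 < m)%N])
     alpha x (- m%:Z) (alpha x m%:Z << c *g b >>) = << c *+ degree b *g b >>.
Proof.
(* the multiset stores alpha_(-(n+1)) under the index n, hence the shift *)
rewrite (fsbigE [seq n.+1 | n <- finsupp b]).
- rewrite big_map /degree sum_mset monalgUMn -[in RHS]sumrMnr.
  under eq_bigl => n do rewrite mem_set //.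
  by apply: eq_bigr => n _; rewrite alpha_number monalgUMn mulnC.
- by rewrite map_inj_uniq ?fset_uniq // => i j [].
- by move=> m /= /mapP[n _ ->].
- move=> [//|n] _; rewrite mem_map; last by move=> i j [].
  rewrite msuppE alpha_number => /mset_eq0P ->.
  by rewrite muln0 mulr0n monalgU0.
Qed.

Lemma scale_malgU x c b : x *: << c *g b >> = << x * c *g b >>.
Proof.
by apply/malgP => b'; rewrite mcoeffZ !mcoeffU mulrnAr.
Qed.

Lemma L0_fock_vector x (a : C) c b :
  L0 x a << c *g b >>
  = << ((degree b)%:R + 2^-1 *: x ^+ 2 - a *: x) * c *g b >>.
Proof.
rewrite /L0 sum_alpha_number !alpha_zero /Defs.cscale !scale_malgU.
rewrite -monalgUD -monalgUB; congr (<< _ *g b >>).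
by rewrite mulrBl mulrDl mulr_natl !mulr_algl expr2 -!scalerAl mulrA.
Qed.

Lemma zero_mode_vacuum x w : zero_mode x (vacuum C) w = w.
Proof.
rewrite /zero_mode /vacuum (sum_msupp_single 1 mset0 (fun (c : C) (b : mono) =>
  Defs.cscale c (monomial_mode x (b : multiset nat) ((degree b)%:Z - 1) w))).
  by rewrite /degree enum_mset0 big_nil /Defs.cscale !scale1r.
by rewrite /Defs.cscale !scale0r.
Qed.

End Modes.

(** * The nilpotent part of L_0 and the Jordan coordinates *)

Section Jordan.
Context {C : numFieldType}.
Implicit Types (lam a : C) (k : nat).

(** Completing the square: the linear term disappears because the highest
    weight equals a. *)
Lemma L0_nilpotent_polynomial a l :
  l%:R + 2^-1 *: 'X^2 - a *: 'X - (weight a a l)%:A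
  = 2^-1 *: ('X - a%:P) ^+ 2 :> {poly C}.
Proof.
have half2 : (2^-1 : C)%:P * 2 = 1.
  by rewrite -[2]/(2%:R) -polyC_natr -polyCM mulVf // pnatr_eq0.
rewrite /weight -!mul_polyC !(rmorphB, rmorphD, rmorphM, rmorphXn, rmorph_nat) /=.
rewrite mulr1.
set h := (2^-1)%:P in half2 *.
(* the two sides differ by a multiple of 2 (1 / 2) - 1 *)
apply: subr0_eq; transitivity ((h * 2 - 1) * (a%:P * 'X - a%:P ^+ 2)).
  by ring.
by rewrite half2 subrr mul0r.
Qed.

Lemma L0N_fock_vector a k l (c : Omega a k) (b : mono) :
  degree b = l ->
  L0N a l << c *g b >>
  = << in_qpoly _ (2^-1 *: ('X - a%:P) ^+ 2) * c *g b >>.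
Proof.
move=> degb; rewrite /L0N L0_fock_vector /Defs.cscale scale_malgU -monalgUB degb.
rewrite -mulrBl -(L0_nilpotent_polynomial a l); congr (<< _ * c *g b >>).
rewrite !(rmorphB, rmorphD) /= !linearZ /= !(rmorphXn, rmorph_nat, rmorph1).
by [].
Qed.

Lemma iter_L0N_fock_vector a k l j (c : Omega a k) (b : mono) :
  degree b = l ->
  iter j (L0N a l) << c *g b >>
  = << in_qpoly _ (2^-1 ^+ j *: ('X - a%:P) ^+ (2 * j)) * c *g b >>.
Proof.
move=> degb; elim: j => [|j IHj] /=.
  by rewrite muln0 !expr0 scale1r rmorph1 mul1r.
rewrite IHj L0N_fock_vector // mulrA -rmorphM /= -scalerAl -scalerAr scalerA.
by rewrite -exprS -exprD mulnS.
Qed.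

(** The class of t^i, with t = x - lam, is the Jordan vector u_(k-i) if i < k and
    zero otherwise. *)
Lemma jcoord_in_qpoly_exp lam k r i :
  (0 < k)%N ->
  jcoord r (in_qpoly (('X - lam%:P) ^+ k) (('X - lam%:P) ^+ i))
  = ((i < k) && (i == k - r))%N%:R.
Proof.
move=> k_gt0.
have hk : mk_monic (('X - lam%:P) ^+ k) = ('X - lam%:P) ^+ k.
  by rewrite /mk_monic size_exp_XsubC ltnS k_gt0 monic_exp ?monicXsubC.
rewrite /jcoord /= hk; have [i_lt_k|k_le_i] := ltnP i k.
  rewrite Pdiv.Ring.rmodp_small ?size_exp_XsubC // rmorphXn /= comp_polyB.
  by rewrite comp_polyX comp_polyC addrK coefXn eq_sym.
rewrite -(subnK k_le_i) exprD Pdiv.RingMonic.rmodp_mull ?monic_exp ?monicXsubC //.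
by rewrite comp_poly0 coef0.
Qed.

Lemma degree_monomial l (i : 'I_(npart l)) : degree (monomial l i) = l.
Proof.
have : monomial l i \in monomials l by apply: mem_nth.
rewrite /monomials; set S := [set _ | _]%classic.
have [fin|inf] := pselect (finite_set S); first by rewrite in_fset_set // inE.
(* on an infinite set fset_set is empty, so that it has no member *)
by rewrite /fset_set; case: pselect.
Qed.

(** The pseudo-trace reads off the u_1-coordinate of (t^2 / 2)^j u_k, while the
    even powers of t only reach the u_r with k - r even. *)
Lemma pstr_iter_L0N_even a m l j (c : C) :
  (1 <= m)%N ->
  pstr (fun w : Defs.induced a (2 * m) => Defs.cscale c (iter j (L0N a l) w)) l = 0.
Proof.
move=> m_gt0; have k_gt0 : (0 < 2 * m)%N by rewrite muln_gt0.
rewrite /pstr /mxtrace big1 // => i _; rewrite /block mxE /fock_basis.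
rewrite iter_L0N_fock_vector ?degree_monomial // /Defs.cscale scale_malgU mcoeffUU.
rewrite /jordan subnn expr0 rmorph1 mulr1 mulr_algl linearZ /= scalerA.
set q := in_qpoly _ _.
have -> : jcoord 1 ((c * 2^-1 ^+ j) *: q) = (c * 2^-1 ^+ j) * jcoord 1 q.
  by rewrite /jcoord poly_of_qpolyZ comp_polyZ coefZ.
rewrite jcoord_in_qpoly_exp //.
(* 2 j is even, whereas k - 1 = 2 m - 1 is odd *)
have -> : (2 * j == 2 * m - 1)%N = false.
  by apply/negbTE/eqP; lia.
by rewrite andbF mulr0.
Qed.

End Jordan.

(** * Graded pseudo-traces *)

Theorem corollary4p7 (R : realType) (a : R[i]) (m : nat) (hm : (1 <= m)%N)
    (tau : R[i]) (htau : 0 < complex.Im tau) :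
  gpstr_converges a a (2 * m)%N (vacuum R[i]) tau /\
  gpstr a a (2 * m)%N (vacuum R[i]) tau = 0.
Proof.
(* the vacuum acts as the identity, and the powers of L0N have zero pseudo-trace *)
have term0 l : gpstr_term a a (2 * m) (vacuum R[i]) tau l = fun=> 0.
  apply/funext => j; rewrite /gpstr_term.
  under [X in pstr X]funext => w do rewrite zero_mode_vacuum.
  by rewrite pstr_iter_L0N_even // !mul0r.
have series0 : series (fun=> 0 : R[i]^o) = fun=> 0.
  by apply/funext => n; rewrite /series /= big1.
have lim0 : limn (fun=> 0 : R[i]^o) = 0 by exact: lim_cst.
rewrite /gpstr /gpstr_converges.
have -> : (fun l => limn (series (gpstr_term a a (2 * m) (vacuum R[i]) tau l)))
          = fun=> 0.
  by apply/funext => l; rewrite term0 series0.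
split; last by rewrite series0.
by split=> [l|]; rewrite ?term0 series0; exact: is_cvg_cst.
Qed.
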